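(* Let $W$ be a finite-dimensional representation of $\mathfrak{su}(2)$, not necessarily irreducible, with orthonormal weight basis $e_1,\dots,e_D$ and weights $\alpha_1,\dots,\alpha_D$. Let $N\ge 2$, let $V=W^{\otimes N}$, and let $V_{(w)}\subseteq V$ be the constant weight subspace of weight $w$. Fix an integer $1\le M\le N-1$ and a multi-index $I_0=(i_1,\dots,i_M)\in\{1,\dots,D\}^M$ such that the equation $$\sum_{k=M+1}^{N}x_k = w-\mathrm{weight}(I_0),\qquad x_k\in\{\alpha_1,\dots,\alpha_D\},$$ has at least one solution $(x_{M+1},\dots,x_N)$. Then there exist real numbers $b_1,\dots,b_D$, not all zero, such that for every $\psi\in V_{(w)}$, $$\sum_{r=1}^{D} b_r\sum_{s=M+1}^{N}\rho^{\{1,\dots,M,s\}}_{(I_0;r)}(\psi)=0 .$$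
   Context: Each finite-dimensional representation $W$ of $\mathfrak{su}(2)$ (not necessarily irreducible), of dimension $D$, is equipped with a Hermitian inner product for which its decomposition into irreducibles is orthogonal, and with an orthonormal basis $e_1,\dots,e_D$ of eigenvectors of $H$, with $He_r=\alpha_r e_r$. Here $H,X,Y$ is the standard basis with $[H,X]=2X$, $[H,Y]=-2Y$, $[X,Y]=H$, so weights are integers (twice the spin). The $\alpha_r$ are listed with multiplicity. $V=\bigotimes_{k=1}^N V_k$ with every $V_k=W$ has the orthonormal basis $e_I=e_{i_1}\otimes\cdots\otimes e_{i_N}$, $I=(i_1,\dots,i_N)\in\{1,\dots,D\}^N$. For a multi-index $I=(i_1,\dots,i_m)$ of any length, $\mathrm{weight}(I)=\alpha_{i_1}+\cdots+\alpha_{i_m}$. The constant weight subspace $V_{(w)}$ is the span of all $e_I$ with $I\in\{1,\dots,D\}^N$ and $\mathrm{weight}(I)=w$. For $\psi=\sum_I a_I e_I\in V$, $I_0=(i_1,\dots,i_M)$, $s\in\{M+1,\dots,N\}$ and $r\in\{1,\dots,D\}$, the number $\rho^{\{1,\dots,M,s\}}_{(I_0;r)}(\psi)$ is the diagonal entry at $e_{i_1}\otimes\cdots\otimes e_{i_M}\otimes e_r$ of the partial trace of $\psi\otimes\psi^*$ over all tensor factors other than $1,\dots,M,s$, i.e. $$\rho^{\{1,\dots,M,s\}}_{(I_0;r)}(\psi)=\sum_{J}|a_J|^2,$$ the sum running over all $J=(j_1,\dots,j_N)\in\{1,\dots,D\}^N$ with $j_k=i_k$ for $1\le k\le M$ and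 $j_s=r$.
   Formalization: The representation W is additionally assumed nontrivial (su(2) does not act by zero): for a trivial W all weights are 0, w = 0, and the states e_{I_0}⊗e_r⊗…⊗e_r force every b_r = 0, so the claim fails. *)

(* Defs.v *)
From HB Require Import structures.
From mathcomp Require Import all_boot all_order all_algebra.
From mathcomp Require Import sesquilinear spectral.
From mathcomp Require Import reals complex.
Set Implicit Arguments.
Unset Strict Implicit.
Unset Printing Implicit Defensive.
Import Order.TTheory GRing.Theory Num.Theory.
Local Open Scope ring_scope.
Local Open Scope sesquilinear_scope.

(* [R : realType] is the field of real numbers and [R[i]] the
   field of complex numbers. *)

(* The real Lie algebra su(2): traceless skew-Hermitian 2 x 2 matrices. *)
Definition su2 (R : realType) : {pred 'M[R[i]]_2} :=
  [pred A : 'M[R[i]]_2 | (A ^t* == - A) && (\tr A == 0)].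
Arguments su2 R : clear implicits.

(* Only the values of [pi] on su(2) are meaningful.  [\o] rather than ring
   multiplication is used, since the latter reverses composition on 'End(W). *)
Definition su2_representation (R : realType) (W : vectType R[i])
    (pi : 'M[R[i]]_2 -> 'End(W)) : Prop :=
  [/\ {in su2 R &, forall A B, pi (A + B) = pi A + pi B},
      forall a : R, {in su2 R, forall A, pi ((a%:C)%C *: A) = (a%:C)%C *: pi A}
    & {in su2 R &, forall A B,
        pi (A *m B - B *m A) = (pi A \o pi B)%VF - (pi B \o pi A)%VF}].

(* When su(2) acts by 0 all weights vanish, no weight vector can be separated
   from another, and there is no nontrivial linear relation to be found. *)
Definition nontrivial_action (R : realType) (W : vectType R[i])
    (pi : 'M[R[i]]_2 -> 'End(W)) : Prop :=
  exists2 A, A \in su2 R & pi A != 0.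

(* Complex-linear extension of [pi] to sl(2,C) = su(2) + i su(2), through the
   unique decomposition Z = A + i B with A = (Z - Z^* )/2, B = (Z + Z^* )/(2i). *)
Definition complexify (R : realType) (W : vectType R[i])
    (pi : 'M[R[i]]_2 -> 'End(W)) (Z : 'M[R[i]]_2) : 'End(W) :=
  pi (2^-1 *: (Z - Z ^t*)) + 'i *: pi ((2 * 'i)^-1 *: (Z + Z ^t*)).

(* H = diag(1, -1); with X = E_{12} and Y = E_{21} it satisfies
   [H, X] = 2 X, [H, Y] = - 2 Y, [X, Y] = H. *)
Definition sl2_H (R : realType) : 'M[R[i]]_2 :=
  \matrix_(i < 2, j < 2) (if i == j then (-1) ^+ i else 0).
Arguments sl2_H R : clear implicits.

Definition subrepresentation (R : realType) (W : vectType R[i])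
    (pi : 'M[R[i]]_2 -> 'End(W)) (U : {vspace W}) : Prop :=
  {in su2 R, forall A, (pi A @: U <= U)%VS}.

Definition irreducible_subrep (R : realType) (W : vectType R[i])
    (pi : 'M[R[i]]_2 -> 'End(W)) (U : {vspace W}) : Prop :=
  [/\ subrepresentation pi U, U <> 0%VS
    & forall U' : {vspace W}, subrepresentation pi U' -> (U' <= U)%VS ->
        U' = 0%VS \/ U' = U].

Definition orthogonal_decomposition (R : realType) (W : vectType R[i])
    (pi : 'M[R[i]]_2 -> 'End(W)) (dot : {dot W for @Num.conj R[i]}) : Prop :=
  exists (m : nat) (U : 'I_m -> {vspace W}),
    [/\ forall k, irreducible_subrep pi (U k),
        directv (\sum_k U k)%VS,
        (\sum_k U k)%VS = fullv
      & forall k l, k != l ->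
          {in U k & U l, forall u v, dot u v = 0}].

Definition multi_index (m D : nat) := {ffun 'I_m -> 'I_D}.

Definition weight (m D : nat) (alpha : 'I_D -> int) (I : multi_index m D) : int :=
  \sum_k alpha (I k).

(* The N-th tensor power of a D-dimensional complex space with a fixed basis
   [e], each tensor being given by its coefficients a_I on the e_I. *)
Definition tensor_power (R : realType) (N D : nat) :=
  {ffun multi_index N D -> (R[i])^o}.

Definition pure_tensor (R : realType) (W : vectType R[i]) (N D : nat)
    (e : D.-tuple W) (v : 'I_N -> W) : tensor_power R N D :=
  [ffun J : multi_index N D => \prod_k coord e (J k) (v k)].

Definition tensor_basis (R : realType) (W : vectType R[i]) (N D : nat)
    (e : D.-tuple W) (I : multi_index N D) : tensor_power R N D :=
  pure_tensor e (fun k => tnth e (I k)).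

Lemma tensor_basisE (R : realType) (W : vectType R[i]) (N D : nat)
    (e : D.-tuple W) (I J : multi_index N D) :
  free e -> tensor_basis e I J = (I == J)%:R.
Proof.
move=> fe; rewrite ffunE; case: eqVneq => [<-|neqIJ].
  by rewrite big1 // => k _; rewrite (tnth_nth 0) coord_free // eqxx.
have [k neqk] : exists k, I k != J k.
  apply/existsP; apply: contraNT neqIJ => /existsPn eqIJ.
  by apply/eqP/ffunP => k; apply/eqP; have := eqIJ k; rewrite negbK.
rewrite (bigD1 k) //= (tnth_nth 0) coord_free //.
by rewrite (_ : _ == _ = false) ?mul0r //;
apply: contraNF neqk => E; apply/eqP/val_inj; apply/eqP; rewrite //= eq_sym.
Qed.

Definition constant_weight_space (R : realType) (W : vectType R[i]) (N D : nat)
    (e : D.-tuple W) (alpha : 'I_D -> int) (w : int) :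
    {vspace tensor_power R N D} :=
  <<[seq tensor_basis e J |
      J in [pred J : multi_index N D | weight alpha J == w]]>>%VS.

(* Matrix entries of psi (x) psi^* in the basis e_I. *)
Definition rank_one (R : realType) (N D : nat) (psi : tensor_power R N D)
    (I J : multi_index N D) : R[i] :=
  (psi I : R[i]) * Num.conj (psi J : R[i]).

Definition sub_index (N D : nat) (S : {set 'I_N}) :=
  {ffun {k : 'I_N | k \in S} -> 'I_D}.

Definition restrict (N D : nat) (S : {set 'I_N}) (I : multi_index N D) :
  sub_index D S := [ffun k => I (val k)].

(* Partial trace over the tensor factors outside [S]. *)
Definition partial_trace (R : realType) (N D : nat) (S : {set 'I_N})
    (T : multi_index N D -> multi_index N D -> R[i])
    (K L : sub_index D S) : R[i] :=
  \sum_(I : multi_index N D | restrict S I == K)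
   \sum_(J : multi_index N D | (restrict S J == L) &&
                               (restrict (~: S) I == restrict (~: S) J)) T I J.

(* Factors are numbered from 0: {1,...,M} is [k < M], and s > M is [M <= s]. *)
Definition first_and (N M : nat) (s : 'I_N) : {set 'I_N} :=
  s |: [set k : 'I_N | (k < M)%N].

(* (I0; r): the entries of [I0] on the first [M] factors, [r] at [s]. *)
Definition extend_index (N M D : nat) (s : 'I_N) (I0 : multi_index M D)
    (r : 'I_D) : sub_index D (first_and M s) :=
  [ffun k => oapp I0 r (insub (nat_of_ord (val k)))].

Definition rho (R : realType) (N M D : nat) (I0 : multi_index M D) (s : 'I_N)
    (r : 'I_D) (psi : tensor_power R N D) : R[i] :=
  partial_trace (rank_one psi) (extend_index s I0 r) (extend_index s I0 r).

Lemma rhoE (R : realType) (N M D : nat) (I0 : multi_index M D) (s : 'I_N)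
    (r : 'I_D) (psi : tensor_power R N D) (leMN : (M <= N)%N) : (M <= s)%N ->
  rho I0 s r psi =
  \sum_(J : multi_index N D |
      [forall k : 'I_M, J (widen_ord leMN k) == I0 k] && (J s == r))
    `|psi J : R[i]| ^+ 2.
Proof.
move=> leMs; rewrite /rho /partial_trace.
apply: eq_big => [I|I /eqP EI].
  apply/eqP/andP => [/ffunP EI|[/forallP EI /eqP Es]].
    split; last first.
      have := EI (exist _ s (setU11 _ _)); rewrite !ffunE /= => ->.
      by rewrite insubF //= ltnNge leMs.
    apply/forallP => k.
    have kS : widen_ord leMN k \in first_and M s by rewrite !inE /= ltn_ord orbT.
    have := EI (exist _ (widen_ord leMN k) kS); rewrite !ffunE /= => ->.
    by rewrite valK.
  apply/ffunP => -[k kS]; rewrite !ffunE /=; case: insubP => [j _ Ej|] /=.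
    by rewrite -(eqP (EI j)); congr (I _); apply: val_inj.
  move: kS; rewrite !inE => /orP[/eqP-> //|ltkM]; by rewrite ltkM.
rewrite (big_pred1 I) => [|J]; first by rewrite /rank_one normCK.
rewrite -EI; apply/andP/eqP => [[/eqP/ffunP E1 /eqP/ffunP E2]|->]; last by [].
apply/ffunP => k; case: (boolP (k \in first_and M s)) => kS.
  by have := E1 (exist _ k kS); rewrite !ffunE.
have kS' : k \in ~: first_and M s by rewrite inE.
by have := E2 (exist _ k kS'); rewrite !ffunE.
Qed.

(* Main.v *)
(* Let m = N - M and w0 = w - weight I0, and take b_r = m alpha_r - w0.  By
   rhoE the double sum collects, for every J extending I0, the term
   |a_J|^2 \sum_(s >= M) b_(J s), and when weight J = w the inner sum is
   m w0 - m w0 = 0.  If all b_r vanished then H would act by a scalar; brackets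
   with H would then act by 0, and since these and their own brackets span
   su(2), the whole action would be trivial. *)
Require Import Defs.
From mathcomp Require Import all_boot all_order all_algebra.
From mathcomp Require Import sesquilinear reals complex.
From mathcomp Require Import ring lra.
Set Implicit Arguments.
Unset Strict Implicit.
Unset Printing Implicit Defensive.
Import Order.TTheory GRing.Theory Num.Theory.
Local Open Scope ring_scope.

Section Su2.
Variable R : realType.
Local Notation C := R[i].

(* [i] times the Pauli matrices: a real basis of su(2). *)
Definition pauli_z : 'M[C]_2 :=
  \matrix_(i < 2, j < 2) (if i == j then 'i * (-1) ^+ i else 0).
Definition pauli_y : 'M[C]_2 :=
  \matrix_(i < 2, j < 2) (if i == j then 0 else (-1) ^+ i).
Definition pauli_x : 'M[C]_2 :=
  \matrix_(i < 2, j < 2) (if i == j then 0 else 'i).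

Lemma pauli_z_su2 : pauli_z \in su2 R.
Proof.
rewrite inE; apply/andP; split; apply/eqP.
  apply/matrixP => j k; rewrite !mxE eq_sym.
  case: (j =P k) => [->|_]; last by rewrite rmorph0 oppr0.
  rewrite rmorphM rmorphXn rmorphN1 /=.
  by rewrite conjCi mulNr.
by rewrite /mxtrace big_ord_recl big_ord1 !mxE /= mulr1 mulrN1 subrr.
Qed.

Lemma pauli_y_su2 : pauli_y \in su2 R.
Proof.
rewrite inE; apply/andP; split; apply/eqP.
  by apply/matrixP => -[[|[|]]//= ?] [[|[|]]//= ?]; rewrite !mxE /= ?rmorph0 ?rmorph1
    ?rmorphXn ?rmorphN1 ?expr1 ?oppr0 ?opprK.
by rewrite /mxtrace big_ord_recl big_ord1 !mxE /= addr0.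
Qed.

Lemma pauli_x_su2 : pauli_x \in su2 R.
Proof.
rewrite inE; apply/andP; split; apply/eqP.
  by apply/matrixP => j k; rewrite !mxE eq_sym; case: ifP => _;
    rewrite ?rmorph0 ?oppr0 ?conjCi.
by rewrite /mxtrace big_ord_recl big_ord1 !mxE /= addr0.
Qed.

(** Every basis element is half a bracket of the other two, so vanishing of the action spreads from
    one to the next. *)
Lemma pauli_comm :
  [/\ pauli_z *m pauli_y - pauli_y *m pauli_z = (2%:C)%C *: pauli_x,
      pauli_x *m pauli_z - pauli_z *m pauli_x = (2%:C)%C *: pauli_y
    & pauli_y *m pauli_x - pauli_x *m pauli_y = (2%:C)%C *: pauli_z].
Proof.
have i2 : 'i * 'i = -1 :> C by rewrite -expr2 sqrCi.
have -> : (2%:C)%C = 1 + 1 :> C by rewrite -[2]/(1 + 1) rmorphD rmorph1.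
split; apply/matrixP => -[[|[|]]//= ?] [[|[|]]//= ?];
  rewrite !mxE !big_ord_recl !big_ord0 !mxE /= ?expr0 ?expr1; ring: i2.
Qed.

(** Skew-Hermitian symmetry makes the upper left entry [z] imaginary and the lower left one minus
    the conjugate of the upper right one [u]; the zero trace fixes the last entry. Three real
    parameters remain. *)
Lemma su2_pauli (A : 'M[C]_2) : A \in su2 R ->
  exists a b c : R, A =
    ((a%:C)%C *: pauli_z + (b%:C)%C *: pauli_y) + (c%:C)%C *: pauli_x.
Proof.
rewrite inE => /andP[/eqP/matrixP AE /eqP].
rewrite /mxtrace big_ord_recl big_ord1 => trA.
have A00 := AE ord0 ord0; have A10 := AE (lift ord0 ord0) ord0.
rewrite !mxE in A00 A10.
set z := A ord0 ord0 in A00 trA; set u := A ord0 (lift ord0 ord0) in A10.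
exists (complex.Im z), (complex.Re u), (complex.Im u).
have uE : u = (complex.Re u)%:C%C + 'i * (complex.Im u)%:C%C.
  by rewrite -complexiE; exact: complexE.
have zE : z = 'i * (complex.Im z)%:C%C.
  rewrite {1}[z]complexE complexiE; suff -> : complex.Re z = 0 by rewrite add0r.
  have := congr1 (@complex.Re R) A00; case: (z) => x y /= xx.
  by lra.
have uJ : Num.conj u = (complex.Re u)%:C%C - 'i * (complex.Im u)%:C%C.
  have realJ x : Num.conj (x%:C)%C = (x%:C)%C :> C by exact: conjc_real.
  by rewrite {1}uE rmorphD rmorphM /= conjCi mulNr !realJ.
apply/matrixP => -[[|[|]]//= p] [[|[|]]//= q];
  rewrite !mxE /= ?expr0 ?expr1 !(mulr0, mulr1, mulrN1, mulrN, addr0, add0r).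
- by rewrite mulrC -zE; congr (A _ _); apply: val_inj.
- by rewrite [X in _ + X]mulrC -uE; congr (A _ _); apply: val_inj.
- rewrite -[LHS]opprK (_ : - A _ _ = Num.conj u).
    by rewrite uJ opprB addrC mulrC.
  by rewrite A10; congr (- A _ _); apply: val_inj.
- rewrite mulrC -zE; apply/eqP; rewrite -addr_eq0 addrC -trA; apply/eqP.
  by congr (_ + A _ _); apply: val_inj.
Qed.

End Su2.

Section Rep.
Variables (R : realType) (W : vectType R[i]) (pi : 'M[R[i]]_2 -> 'End(W)).
Hypothesis pi_rep : su2_representation pi.

Lemma su2_rep0 : pi 0 = 0.
Proof.
have [_ piZ _] := pi_rep; have := piZ 0 _ (pauli_z_su2 R).
by rewrite rmorph0 !scale0r.
Qed.

Let half_iE (x : R[i]) : (2 * 'i)^-1 * (x + x) = - ('i * x).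
Proof.
rewrite invfM invCi -mulr2n -[x *+ 2]mulr_natl mulrACA mulVf ?pnatr_eq0 //.
by rewrite mul1r mulNr.
Qed.

(** [sl2_H] is Hermitian, so its component A in su(2) is zero and B = -i H, which is [- pauli_z]. *)
Lemma complexify_sl2_H : complexify pi (sl2_H R) = 'i *: pi (- pauli_z R).
Proof.
have HJ : map_mx Num.conj (sl2_H R)^T = sl2_H R.
  apply/matrixP => j k; rewrite !mxE eq_sym.
  by case: (j =P k) => [->|_]; rewrite ?rmorphXn ?rmorphN1 ?rmorph0.
rewrite /complexify HJ subrr scaler0 su2_rep0 add0r; congr (_ *: pi _).
apply/matrixP => j k; rewrite !mxE; case: ifP => _;
  last by rewrite addr0 mulr0 oppr0.
exact: half_iE.
Qed.

Lemma scalar_H_trivial (k : R[i]) : complexify pi (sl2_H R) = k *: \1%VF ->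
  {in su2 R, forall A, pi A = 0}.
Proof.
have [piD piZ piM] := pi_rep.
rewrite complexify_sl2_H => piH.
have pizE : pi (- pauli_z R) = (- 'i * k) *: \1%VF.
  by rewrite -scalerA -piH scalerA mulNr -expr2 sqrCi opprK scale1r.
(* The sign comes out as the real scalar -1, by real homogeneity on su(2). *)
have piN : pi (- pauli_z R) = - pi (pauli_z R).
  by rewrite -scaleN1r -(rmorphN1 (real_complex R)) piZ ?pauli_z_su2 // rmorphN1 scaleN1r.
have {pizE piN}pizE : pi (pauli_z R) = ('i * k) *: \1%VF.
  by rewrite -[LHS]opprK -piN pizE mulNr scaleNr opprK.
have pi2 A : A \in su2 R -> pi ((2%:C)%C *: A) = 0 -> pi A = 0.
  move=> suA; rewrite piZ // => /eqP; rewrite scaler_eq0 => /orP[|/eqP//].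
  by rewrite fmorph_eq0 pnatr_eq0.
(* A scalar operator commutes with everything, which kills [pauli_x]. Brackets with [pauli_x] then
   kill [pauli_y], and finally [pauli_z], so far only known to act by a scalar. *)
have [zy xz yx] := pauli_comm R.
have pix : pi (pauli_x R) = 0.
  apply: pi2; rewrite ?pauli_x_su2 // -zy piM ?pauli_z_su2 ?pauli_y_su2 //.
  by rewrite pizE -comp_lfunZl -comp_lfunZr comp_lfun1l comp_lfun1r subrr.
have piy : pi (pauli_y R) = 0.
  apply: pi2; rewrite ?pauli_y_su2 // -xz piM ?pauli_z_su2 ?pauli_x_su2 //.
  by rewrite pix comp_lfun0l comp_lfun0r subrr.
have piz : pi (pauli_z R) = 0.
  apply: pi2; rewrite ?pauli_z_su2 // -yx piM ?pauli_y_su2 ?pauli_x_su2 //.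
  by rewrite pix comp_lfun0l comp_lfun0r subrr.
move=> A /su2_pauli[a [b [c ->]]].
(* [pi] is linear only on su(2), so the partial sums of the expansion must be shown to stay
   there. *)
have suZ d B : B \in su2 R -> (d%:C)%C *: B \in su2 R.
  rewrite !inE => /andP[/eqP BE /eqP trB]; rewrite mxtraceZ trB mulr0 eqxx andbT.
  rewrite linearZ /= map_mxZ BE scalerN; apply/eqP.
  by congr (- (_ *: _)); exact: conjc_real.
have suD B E : B \in su2 R -> E \in su2 R -> B + E \in su2 R.
  rewrite !inE => /andP[/eqP BE /eqP trB] /andP[/eqP EE /eqP trE].
  by rewrite mxtraceD linearD /= map_mxD BE EE opprD trB trE addr0 !eqxx.
rewrite !piD ?suD ?suZ ?pauli_x_su2 ?pauli_y_su2 ?pauli_z_su2 //.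
by rewrite !piZ ?pauli_x_su2 ?pauli_y_su2 ?pauli_z_su2 // pix piy piz !scaler0 !addr0.
Qed.

End Rep.

(** Each spanning tensor has a single nonzero coefficient, placed at an index of weight [w]. *)
Lemma constant_weight_spaceP (R : realType) (W : vectType R[i]) (N D : nat)
    (e : D.-tuple W) (alpha : 'I_D -> int) (w : int) (psi : tensor_power R N D)
    (J : multi_index N D) :
  free e -> psi \in constant_weight_space N e alpha w ->
  weight alpha J != w -> psi J = 0.
Proof.
move=> fe + wJ.
rewrite /constant_weight_space -[X in <<X>>%VS]/(val (in_tuple _)) => /coord_span ->.
rewrite sum_ffunE big1 // => k _; rewrite ffunE.
set X := (X in X`_k).
have /imageP[I wI ->] : X`_k \in X by exact: mem_nth.
rewrite tensor_basisE //; case: eqP wI => [->|_ _]; last by rewrite scaler0.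
by rewrite inE (negbTE wJ).
Qed.

Lemma weight_split (N M D : nat) (alpha : 'I_D -> int) (I0 : multi_index M D)
    (J : multi_index N D) (leMN : (M <= N)%N) :
  [forall k : 'I_M, J (widen_ord leMN k) == I0 k] ->
  weight alpha J = weight alpha I0 + \sum_(s < N | (M <= s)%N) alpha (J s).
Proof.
move=> /forallP JI; rewrite /weight (bigID (fun s : 'I_N => (s < M)%N)) /=.
congr (_ + _); last by apply: eq_bigl => s; rewrite -leqNgt.
rewrite (big_ord_narrow leMN); apply: eq_bigr => k _.
by rewrite (eqP (JI k)).
Qed.

Theorem theorem6 (R : realType) (W : vectType R[i])
  (pi : 'M[R[i]]_2 -> 'End(W)) (pi_rep : su2_representation pi)
  (pi_nontriv : nontrivial_action pi)
  (dot : {dot W for @Num.conj R[i]})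
  (dot_decomp : orthogonal_decomposition pi dot)
  (D : nat) (e : D.-tuple W) (e_basis : basis_of fullv e)
  (e_orthonormal : orthonormal dot e)
  (alpha : 'I_D -> int)
  (e_weight : forall r : 'I_D,
     complexify pi (sl2_H R) (tnth e r) = (alpha r)%:~R *: tnth e r)
  (N : nat) (N_ge2 : (2 <= N)%N) (w : int)
  (M : nat) (M_ge1 : (1 <= M)%N) (M_le : (M <= N - 1)%N)
  (I0 : multi_index M D)
  (solvable : exists x : 'I_N -> int,
     (forall k : 'I_N, (M <= k)%N -> exists r : 'I_D, x k = alpha r) /\
     \sum_(k < N | (M <= k)%N) x k = w - weight alpha I0) :
  exists b : 'I_D -> R,
    (exists r : 'I_D, b r <> 0) /\
    forall psi : tensor_power R N D,
      psi \in constant_weight_space N e alpha w ->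
      \sum_(r < D) ((b r)%:C)%C * \sum_(s < N | (M <= s)%N) rho I0 s r psi = 0.
Proof.
have leMN : (M <= N)%N by rewrite (leq_trans M_le) // leq_subr.
(* Subtraction is truncated: [M <= N - 1] gives [M < N] only because [N_ge2] excludes [N = 0]. *)
have mN0 : (N - M)%:R != 0 :> R.
  by rewrite pnatr_eq0 -lt0n subn_gt0; move: M_le N_ge2; case: (N) => // n; rewrite subn1.
pose w0 := w - weight alpha I0.
(* Up to the factor [N - M], this is the deviation of [alpha r] from [w0 / (N - M)], the mean weight
   forced on the last [N - M] factors. *)
exists (fun r => (alpha r *+ (N - M) - w0)%:~R); split.
  have [/existsP[r br]|/existsPn b0] :=
      boolP [exists r, (alpha r *+ (N - M) - w0)%:~R != 0 :> R].
    by exists r; apply/eqP.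
  have [A suA /negP[]] := pi_nontriv; apply/eqP.
  (* If all deviations vanish, every weight equals the mean, which is then the scalar by which H
     acts. *)
  apply: (@scalar_H_trivial _ _ _ pi_rep (w0%:~R / (N - M)%:R)) => //.
  apply/lfunP => v.
  have /span_lfunP : {in e, complexify pi (sl2_H R) =1
      (w0%:~R / (N - M)%:R) *: \1%VF}.
    move=> _ /tnthP[r ->]; rewrite e_weight !lfunE /= lfunE; congr (_ *: _).
    have mC0 : (N - M)%:R != 0 :> R[i] by rewrite pnatr_eq0 -(pnatr_eq0 R).
    apply: (mulIf mC0); rewrite divfK //.
    have := b0 r; rewrite negbK intr_eq0 subr_eq0 => /eqP <-.
    by rewrite rmorphMn /= mulr_natr.
  by apply; rewrite (span_basis e_basis) memvf.
move=> psi psiw.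
pose P (J : multi_index N D) := [forall k : 'I_M, J (widen_ord leMN k) == I0 k].
pose b r : int := alpha r *+ (N - M) - w0.
(* Writing [b (J s)] for [b r] frees the summand of [r]; summing over [r] then only reassembles the
   fibres of [J s]. *)
have rhob (s : 'I_N) r : (M <= s)%N -> (((b r)%:~R : R)%:C)%C * rho I0 s r psi =
    \sum_(J | P J && (J s == r)) (b (J s))%:~R * `|psi J : R[i]| ^+ 2.
  move=> leMs; rewrite (rhoE I0 r psi leMN leMs) mulr_sumr rmorph_int.
  by apply: eq_bigr => J /andP[_ /eqP ->].
transitivity (\sum_(s < N | (M <= s)%N)
    \sum_(J | P J) (b (J s))%:~R * `|psi J : R[i]| ^+ 2).
  under eq_bigr do rewrite mulr_sumr.
  rewrite exchange_big /=; apply: eq_bigr => s leMs.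
  rewrite (partition_big (fun J : multi_index N D => J s) predT) //=.
  by apply: eq_bigr => r _; rewrite rhob.
rewrite exchange_big big1 //= => J PJ; rewrite -mulr_suml -rmorph_sum /=.
(* An index of another weight contributes nothing, its coefficient in [psi] being zero. *)
have [wJ|wJ] := eqVneq (weight alpha J) w; last first.
  by rewrite (constant_weight_spaceP (basis_free e_basis) psiw wJ) normr0 expr0n mulr0.
rewrite (_ : \sum_(s < N | _) _ = 0) ?mul0r // sumrB sumrMnl.
have -> : \sum_(s < N | (M <= s)%N) alpha (J s) = w0.
  by rewrite /w0 -wJ (weight_split alpha PJ) addrC addKr.
rewrite sumr_const (_ : #|_| = (N - M)%N) ?subrr //.
(* The positions [s >= M] are counted as the complement of the first [M] ones. *)
apply/eqP; rewrite -(eqn_add2l M) subnKC //; apply/eqP.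
rewrite -[RHS]card_ord -(cardC [pred s : 'I_N | (s < M)%N]); congr (_ + _)%N.
  by rewrite -sum1_card (big_ord_narrow leMN) sum1_card card_ord.
by apply: eq_card => s; rewrite !inE -leqNgt.
Qed.
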